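(* Let $p$ be a prime and let $R$ be a Noetherian domain of characteristic $p>0$. Let $S$ be any perfect domain that is an integral extension of $R$. If there is a finitely generated ideal of $S$ that is not tightly closed, then $S$ is not coherent.
   Context: All rings are commutative with unit. A ring is coherent if every finitely generated ideal is finitely presented. A ring of characteristic $p>0$ is perfect if its Frobenius map $a\mapsto a^p$ is bijective. For a domain $S$ of characteristic $p>0$ (not necessarily Noetherian), an ideal $I$ and $q=p^e$, $I^{[q]}$ is the ideal generated by the $q$-th powers of all elements of $I$; the tight closure $I^{*}$ of $I$ is the set of $x\in S$ for which there is a nonzero $c\in S$ with $cx^{q}\in I^{[q]}$ for all $q=p^{e}\gg0$. The ideal $I$ is tightly closed if $I=I^{*}$. *)

(* Defs.v *)
From mathcomp Require Import all_boot all_order all_algebra.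
From mathcomp Require Import boolp classical_sets.

Set Implicit Arguments.
Unset Strict Implicit.
Unset Printing Implicit Defensive.

Import GRing.Theory.

Local Open Scope ring_scope.
Local Open Scope classical_set_scope.

(* The unit ideal counts as an ideal, contrary to [idealr_closed] of
   ring_quotient, which only describes proper ideals. *)
Definition is_ideal (A : comNzRingType) (I : set A) : Prop :=
  [/\ I 0,
      forall x y, I x -> I y -> I (x + y) &
      forall a x, I x -> I (a * x)].

Definition ideal_gen (A : comNzRingType) (X : set A) : set A :=
  smallest (@is_ideal A) X.

Definition fg_ideal (A : comNzRingType) (I : set A) : Prop :=
  exists s : seq A, I = ideal_gen [set` s].

Definition noetherian (A : comNzRingType) : Prop :=
  forall I : set A, is_ideal I -> fg_ideal I.

(* Exactness of A^m -> A^n -> I -> 0, the second map being composed with the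
   inclusion of I in A. *)
Definition fp_ideal (A : comNzRingType) (I : set A) : Prop :=
  exists (m n : nat) (h : {linear 'rV[A]_m -> 'rV[A]_n})
         (g : {linear 'rV[A]_n -> A^o}),
    range g = I /\ range h = g @^-1` [set 0].

Definition coherent (A : comNzRingType) : Prop :=
  forall I : set A, fg_ideal I -> fp_ideal I.

Definition perfect (p : nat) (A : comNzRingType) : Prop :=
  p \in [pchar A] /\ bijective (fun a : A => a ^+ p).

Definition integral_extension (R S : comNzRingType) (f : {rmorphism R -> S}) :
  Prop := injective f /\ integralRange f.

Definition frobenius_power (A : comNzRingType) (I : set A) (q : nat) : set A :=
  ideal_gen [set y ^+ q | y in I].

Definition tight_closure (p : nat) (S : idomainType) (I : set S) : set S :=
  [set x | exists2 c : S, c != 0 &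
     exists e0 : nat, forall e : nat, (e0 <= e)%N ->
       frobenius_power I (p ^ e) (c * x ^+ (p ^ e))].

Definition tightly_closed (p : nat) (S : idomainType) (I : set S) : Prop :=
  I = tight_closure p I.

(* Main.v *)
Require Import Defs.
From mathcomp Require Import all_boot all_order all_algebra.
From mathcomp Require Import boolp classical_sets.
From mathcomp Require Import ring.

Set Implicit Arguments.
Unset Strict Implicit.
Unset Printing Implicit Defensive.

Import GRing.Theory.

Local Open Scope ring_scope.
Local Open Scope classical_set_scope.

(** Suppose that [S] is coherent and that [x] lies in the tight closure of [I]
    but not in [I]. Extracting [p^e]-th roots in the relations
    [c * x ^+ (p ^ e) \in I^{[p^e]}], which is possible because Frobenius is
    an automorphism of [S], shows that the colon ideal [J = (I : x)] contains a
    [p^e]-th root of [c] for every large [e] ([tight_closure_roots]). By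
    coherence [J] is finitely generated ([coherent_colon]), and it is proper.
    So everything comes down to [fg_ideal_roots_unit]: a finitely generated
    proper ideal [J] cannot contain [p^e]-th roots of a fixed [c != 0] for all
    large [e].

    The heuristic for the latter is a discrete valuation which is positive on
    [J]: the value of [c] would be at least [p^e] times the least value on [J],
    for all large [e]. The proof carries this out with rings instead of
    valuations. Blow up [J]: by Chevalley's lemma, some generator [a] of [J]
    divides all the others in an extension [T] of [S] inside the fraction field
    in which [a] is still not invertible ([dominating_generator]). Let [B] be
    the subring of [T] generated over [R] by [a], by [c] and by the quotients of
    the generators by [a]. It is Noetherian ([hilbert_basis]) and, if [d] is
    an element of [J] with [d ^+ q = c], then [d / a] is integral over [B]
    because [S] is integral over [R]; hence so is [c / a ^+ q], with [q]
    arbitrarily large.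

    This is impossible since [a^-1] is not in [B]
    ([inv_mem_of_almost_integral]). After localization at a minimal prime of
    [a], the argument of Krull's principal ideal theorem shows that [c] divides
    some [a ^+ k] ([dvd_power_of_minimal]); for [q > k], [a^-1] is then a
    multiple of the integral element [c / a ^+ q], and clearing denominators in
    its integral equation puts [a^-1] into the localization. *)

(** * The maximum condition and the Hilbert basis theorem *)

(** With [Q] the predicate of being an ideal, this is the form of the Noetherian
    property that passes most easily to polynomial rings and localizations. *)
Definition max_condition (T : Type) (Q : set (set T)) : Prop :=
  forall F : set (set T), F !=set0 -> F `<=` Q ->
    exists2 M, F M & forall N, F N -> M `<=` N -> N `<=` M.

(** To be applied to the preimage of ideals under a ring morphism, and to the
    trace on a ring of the ideals of its localization. *)
Lemma max_condition_pullback (T T' : Type) (Q : set (set T))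
    (Q' : set (set T')) (phi : set T -> set T') :
  (forall U, Q U -> Q' (phi U)) ->
  {homo phi : U V / U `<=` V} ->
  (forall U V, Q U -> Q V -> phi V `<=` phi U -> V `<=` U) ->
  max_condition Q' -> max_condition Q.
Proof.
move=> phiQ phi_homo phi_refl maxQ' F [U FU] FQ.
have [||_ [M FM <-] Mmax] := maxQ' (phi @` F).
- by exists (phi U), U.
- by move=> _ [V FV <-]; apply/phiQ/FQ.
exists M => // N FN MN; apply: phi_refl; [exact: FQ..|].
by apply: Mmax; [exists N | exact: phi_homo].
Qed.

Lemma chain_finite_subset (T : eqType) (C : set (set T)) (s : seq T) :
  C !=set0 -> total_on C subset ->
  [set` s] `<=` \bigcup_(X in C) X -> exists2 X, C X & [set` s] `<=` X.
Proof.
move=> [X0 CX0] Ctot; elim: s => [|a s IHs] sC; first by exists X0.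
have [|X CX sX] := IHs.
  by move=> y sy; apply: sC; rewrite /= inE (_ : y \in s) ?orbT.
have [|Y CY Ya] := sC a; first by rewrite /= mem_head.
have [XY|YX] := Ctot _ _ CX CY.
- by exists Y => // y /=; rewrite inE => /orP[/eqP-> //|/sX/XY].
- by exists X => // y /=; rewrite inE => /orP[/eqP->|/sX //]; apply: YX.
Qed.

Lemma noetherian_max_condition (A : comNzRingType) :
  noetherian A -> max_condition (@is_ideal A).
Proof.
move=> noethA F [U0 FU0] FI.
(* The empty set is thrown in because Zorn's lemma also asks for an upper
   bound of the empty chain. *)
have [|M [PM Mmax]] := @Zorn_bigcup A [set X | X = set0 \/ F X].
- move=> C CP Ctot.
  have [[X0 CX0 X0n0]|C0] := pselect (exists2 X, C X & X <> set0); last first.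
    left; rewrite -subset0 => x [X CX Xx]; case: C0; exists X => //.
    by move=> X0; rewrite X0 in Xx.
  have CI X x : C X -> X x -> is_ideal X.
    move=> CX Xx; apply: FI; case: (CP _ CX) => // X00.
    by rewrite X00 in Xx.
  have [z X0z] : X0 !=set0 by apply/set0P/eqP.
  have : is_ideal (\bigcup_(X in C) X).
    split.
    - by exists X0 => //; have [] := CI _ _ CX0 X0z.
    - move=> x y [X CX Xx] [Y CY Yy]; have [XY|YX] := Ctot _ _ CX CY.
        exists Y => //; have [_ YD _] := CI _ _ CY Yy.
        by apply: YD => //; apply: XY.
      exists X => //; have [_ XD _] := CI _ _ CX Xx.
      by apply: XD => //; apply: YX.
    - move=> a x [X CX Xx]; exists X => //.
      by have [_ _] := CI _ _ CX Xx; apply.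
  move=> /noethA[s Us]; right.
  have [||X CX sX] := @chain_finite_subset _ C s _ Ctot; first by exists X0.
    by rewrite Us; apply: sub_gen_smallest.
  have sX_union Z : is_ideal Z -> [set` s] `<=` Z -> \bigcup_(X in C) X `<=` Z.
    by move=> idZ sZ; rewrite Us; apply: smallest_sub.
  have [X00|FX] := CP _ CX; last first.
    suff -> : \bigcup_(X in C) X = X by [].
    rewrite eqEsubset; split=> [|x Xx]; last by exists X.
    by apply: sX_union => //; apply: FI.
  (* The generators lie in the empty member: the union is the zero ideal, and
     so is X0. *)
  suff -> : \bigcup_(X in C) X = X0 by case: (CP _ CX0).
  rewrite eqEsubset; split; last by move=> x X0x; exists X0.
  apply: sX_union; first exact: CI CX0 X0z.
  by move=> y /sX; rewrite X00.
- case: PM => [M0|FM].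
    case: (Mmax U0) => //; last by right.
    rewrite M0; split=> [x|]; first by [].
    by have [U00 _ _] := FI _ FU0; move/(_ 0 U00).
exists M => // N FN MN; apply: contrapT => NM.
by apply: (Mmax N); [split | right].
Qed.

Definition lead_coefs (A : comNzRingType) (n : nat) (U : set {poly A}) :
    set A :=
  [set b | exists f, [/\ U f, (size f <= n.+1)%N & f`_n = b]].

Lemma lead_coefs_ideal (A : comNzRingType) n (U : set {poly A}) :
  is_ideal U -> is_ideal (lead_coefs n U).
Proof.
move=> [U0 UD UM]; split.
- by exists 0; rewrite size_poly0 coef0.
- move=> _ _ [f [Uf sf <-]] [g [Ug sg <-]]; exists (f + g).
  rewrite coefD; split=> //; first exact: UD.
  by rewrite (leq_trans (size_polyD _ _)) // geq_max sf.
- move=> a _ [f [Uf sf <-]]; exists (a%:P * f); rewrite coefCM; split=> //.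
    exact: UM.
  by rewrite mul_polyC (leq_trans (size_scale_leq _ _)).
Qed.

Lemma lead_coefsS (A : comNzRingType) n (U V : set {poly A}) :
  U `<=` V -> lead_coefs n U `<=` lead_coefs n V.
Proof. by move=> UV b [f [Uf sf fb]]; exists f; split=> //; apply: UV. Qed.

Lemma lead_coefs_mono (A : comNzRingType) m n (U : set {poly A}) :
  is_ideal U -> (m <= n)%N -> lead_coefs m U `<=` lead_coefs n U.
Proof.
move=> [_ _ UM] mn b [f [Uf sf <-]]; exists ('X^(n - m) * f); split.
- exact: UM.
- rewrite (leq_trans (size_polyMleq _ _)) // size_polyXn addSn /=.
  by rewrite (leq_trans (leq_add (leqnn _) sf)) // addnS subnK.
- by rewrite coefXnM ltnNge leq_subr /= subKn.
Qed.

(** An element of [V] is reduced into [U] by cancelling its leading terms one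
    after the other. *)
Lemma sub_of_lead_coefs (A : comNzRingType) (U V : set {poly A}) :
  is_ideal U -> is_ideal V -> U `<=` V ->
  (forall n, lead_coefs n V `<=` lead_coefs n U) -> V `<=` U.
Proof.
move=> [U0 UD UM] [V0 VD VM] UV lcVU f Vf.
have [n] := ubnP (size f); elim: n => // n IHn in f Vf *.
rewrite ltnS leq_eqVlt => /orP[/eqP sf|]; last exact: IHn.
case: n sf IHn => [/eqP|n] sf IHn.
  by move: sf; rewrite size_poly_eq0 => /eqP->.
have [|g [Ug sg gf]] := lcVU n f`_n; first by exists f; rewrite sf.
rewrite -(subrK g f); apply: UD => //; apply: IHn.
  by apply: VD => //; rewrite -mulN1r; apply: VM; apply: UV.
rewrite ltnS; apply/leq_sizeP => j; rewrite leq_eqVlt => /orP[/eqP<-|nj].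
  by rewrite coefB gf subrr.
by rewrite coefB !nth_default ?subrr ?sf // (leq_trans sg).
Qed.

(** Hilbert's basis theorem. In a family of ideals, first the leading
    coefficients are maximized among all degrees simultaneously; this settles
    the degrees from some N on, and the finitely many lower ones are then
    maximized successively. *)
Lemma hilbert_basis (A : comNzRingType) :
  max_condition (@is_ideal A) -> max_condition (@is_ideal {poly A}).
Proof.
move=> maxA F [V0 FV0] FI.
have [||_ [N [U0 FU0 <-]] U0max] :=
    maxA [set L | exists n, exists2 U, F U & lead_coefs n U = L].
- by exists (lead_coefs 0 V0), 0, V0.
- by move=> _ [n [U FU <-]]; apply/lead_coefs_ideal/FI.
have low k : exists U, [/\ F U, U0 `<=` U & forall n V, (n < k)%N ->
    F V -> U `<=` V -> lead_coefs n V `<=` lead_coefs n U].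
  elim: k => [|k [U [FU U0U Umax]]]; first by exists U0; split.
  have [||_ [U' [FU' UU'] <-] U'max] :=
    maxA [set L | exists2 V, F V /\ U `<=` V & lead_coefs k V = L].
  - by exists (lead_coefs k U); exists U => //; split=> // x.
  - by move=> _ [V [FV _] <-]; apply/lead_coefs_ideal/FI.
  exists U'; split=> // [|n V]; first exact: subset_trans UU'.
  rewrite ltnS leq_eqVlt => /orP[/eqP->|nk] FV U'V.
    apply: U'max; last exact: lead_coefsS.
    by exists V => //; split=> //; apply: subset_trans U'V.
  have UV := subset_trans UU' U'V.
  exact: subset_trans (Umax _ _ nk FV UV) (lead_coefsS UU').
have [U [FU U0U Umax]] := low N.
exists U => // V FV UV; apply: sub_of_lead_coefs; [exact: FI..|exact: UV|].
move=> n; have [nN|Nn] := ltnP n N; first exact: Umax.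
have VU0 : lead_coefs n V `<=` lead_coefs N U0.
  apply: U0max; first by exists n, V.
  apply: subset_trans (lead_coefsS (subset_trans U0U UV)).
  by apply: lead_coefs_mono => //; apply: FI.
apply: (subset_trans VU0); apply: subset_trans (lead_coefsS U0U) _.
by apply: lead_coefs_mono => //; apply: FI.
Qed.

(** * Subrings of a field *)

(** Subrings are handled as subsets of one ambient ring, so that enlarging or
    localizing them involves no transport of structure. *)
Definition subring (K : comNzRingType) (T : set K) : Prop :=
  [/\ T 1, forall x y, T x -> T y -> T (x - y) &
      forall x y, T x -> T y -> T (x * y)].

Definition submodule (K : comNzRingType) (T I : set K) : Prop :=
  [/\ I 0, forall x y, I x -> I y -> I (x + y) &
      forall t x, T t -> I x -> I (t * x)].

Definition ideal_in (K : comNzRingType) (T I : set K) : Prop :=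
  submodule T I /\ I `<=` T.

Section Subring.
Variables (K : comNzRingType) (T I : set K).
Hypothesis ringT : subring T.
Hypothesis modI : submodule T I.

Lemma subring1 : T 1. Proof. by case: ringT. Qed.

Lemma subring0 : T 0.
Proof. by case: ringT => T1 TB _; rewrite -(subrr 1); apply: TB. Qed.

Lemma subringB x y : T x -> T y -> T (x - y).
Proof. by case: ringT => _ TB _; apply: TB. Qed.

Lemma subringN x : T x -> T (- x).
Proof. by rewrite -sub0r; apply: subringB; apply: subring0. Qed.

Lemma subringD x y : T x -> T y -> T (x + y).
Proof. by move=> Tx /subringN; rewrite -{2}(opprK y); apply: subringB. Qed.

Lemma subringM x y : T x -> T y -> T (x * y).
Proof. by case: ringT => _ _ TM; apply: TM. Qed.

Lemma subringX x n : T x -> T (x ^+ n).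
Proof.
move=> Tx; elim: n => [|n IHn]; first exact: subring1.
by rewrite exprS; apply: subringM.
Qed.

Lemma subring_submodule : submodule T T.
Proof. by split; [apply: subring0 | apply: subringD | apply: subringM]. Qed.

Lemma submodule0 : I 0. Proof. by case: modI. Qed.

Lemma submoduleD x y : I x -> I y -> I (x + y).
Proof. by case: modI => _ ID _; apply: ID. Qed.

Lemma submoduleM t x : T t -> I x -> I (t * x).
Proof. by case: modI => _ _ IM; apply: IM. Qed.

Lemma submoduleN x : I x -> I (- x).
Proof. by rewrite -mulN1r; apply/submoduleM/subringN/subring1. Qed.

Lemma submoduleB x y : I x -> I y -> I (x - y).
Proof. by move=> Ix /submoduleN; apply: submoduleD. Qed.

Lemma submodule_sum n (F : 'I_n -> K) : (forall i, I (F i)) -> I (\sum_i F i).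
Proof.
by move=> IF; elim/big_ind: _; [apply: submodule0 | apply: submoduleD | ].
Qed.

End Subring.

Definition extend (K : comNzRingType) (T I : set K) (x : K) : set K :=
  [set z | exists2 y, I y & exists2 t, T t & z = y + t * x].

Lemma sub_extend (K : comNzRingType) (T I : set K) x :
  subring T -> I `<=` extend T I x.
Proof.
move=> ringT y Iy; exists y => //; exists 0; first exact: subring0.
by rewrite mul0r addr0.
Qed.

Lemma extend_gen (K : comNzRingType) (T I : set K) x :
  subring T -> submodule T I -> extend T I x x.
Proof.
move=> ringT modI; exists 0; first exact: (submodule0 modI).
by exists 1; [apply: subring1 | rewrite mul1r add0r].
Qed.

Lemma extend_submodule (K : comNzRingType) (T I : set K) x :
  subring T -> submodule T I -> submodule T (extend T I x).
Proof.
move=> ringT modI; split.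
- by apply: sub_extend => //; apply: (submodule0 modI).
- move=> _ _ [y Iy [t Tt ->]] [y' Iy' [t' Tt' ->]].
  exists (y + y'); first exact: (submoduleD modI).
  by exists (t + t'); [apply: subringD | rewrite mulrDl addrACA].
- move=> u _ Tu [y Iy [t Tt ->]]; exists (u * y).
    exact: (submoduleM modI).
  by exists (u * t); [apply: subringM | rewrite mulrDr mulrA].
Qed.

Lemma extend_sub (K : comNzRingType) (T I J : set K) x :
  submodule T J -> I `<=` J -> J x -> extend T I x `<=` J.
Proof.
move=> modJ IJ Jx _ [y Iy [t Tt ->]].
by apply: (submoduleD modJ); [apply: IJ | apply: (submoduleM modJ)].
Qed.

(** The trace on [T] of the ideal generated by [b] after inverting [g]. *)
Definition saturation (K : fieldType) (T : set K) (g b : K) : set K :=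
  [set x | T x /\ exists k, T (g ^+ k * x / b)].

Lemma saturation_ideal (K : fieldType) (T : set K) g b :
  subring T -> T g -> ideal_in T (saturation T g b).
Proof.
move=> ringT Tg.
have raise x k l : T (g ^+ k * x / b) -> (k <= l)%N -> T (g ^+ l * x / b).
  move=> Tk kl; rewrite -(subnK kl) exprD -!mulrA; apply: subringM => //.
    exact: subringX.
  by rewrite mulrA.
split; last by move=> x [].
split.
- split; first exact: subring0.
  by exists 0%N; rewrite mulr0 mul0r; apply: subring0.
- move=> x y [Tx [k Tk]] [Ty [l Tl]]; split; first exact: subringD.
  exists (maxn k l); rewrite mulrDr mulrDl; apply: subringD => //.
    exact: raise Tk (leq_maxl _ _).
  exact: raise Tl (leq_maxr _ _).
- move=> t x Tt [Tx [k Tk]]; split; first exact: subringM.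
  by exists k; rewrite mulrCA -mulrA; apply: subringM.
Qed.

Lemma image_subring (A K : comNzRingType) (f : {rmorphism A -> K}) :
  subring (range f).
Proof.
split; first by exists 1; rewrite ?rmorph1.
- by move=> _ _ [x _ <-] [y _ <-]; exists (x - y); rewrite ?rmorphB.
- by move=> _ _ [x _ <-] [y _ <-]; exists (x * y); rewrite ?rmorphM.
Qed.

Lemma max_condition_image (A K : comNzRingType) (f : {rmorphism A -> K}) :
  max_condition (@is_ideal A) -> max_condition (ideal_in (range f)).
Proof.
apply: (max_condition_pullback (phi := fun U => f @^-1` U)).
- move=> U [modU _]; split=> /=.
  + by rewrite rmorph0; apply: (submodule0 modU).
  + by move=> x y Ux Uy; rewrite rmorphD; apply: (submoduleD modU).
  + by move=> t x Ux; rewrite rmorphM; apply: (submoduleM modU).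
- by move=> U V UV x; apply: UV.
- move=> U V _ [_ Vf] VU z Vz; have [x _ xz] := Vf _ Vz.
  by rewrite -xz; apply: VU; rewrite /= xz.
Qed.

(** A ring of fractions of the Noetherian ring [B] is Noetherian, because its
    ideals are determined by their traces on [B]. *)
Lemma max_condition_localization (K : fieldType) (B A : set K) :
  subring B -> B `<=` A ->
  (forall z, A z -> exists w, [/\ B w, A w^-1, w != 0 & B (w * z)]) ->
  max_condition (ideal_in B) -> max_condition (ideal_in A).
Proof.
move=> ringB BA frac; apply: (max_condition_pullback (phi := fun U => U `&` B)).
- move=> U [modU _]; split=> [|z []//]; split.
  + by split; [apply: (submodule0 modU) | apply: subring0].
  + move=> x y [Ux Bx] [Uy By].
    by split; [apply: (submoduleD modU) | apply: subringD].
  + move=> t x Bt [Ux Bx].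
    by split; [apply: (submoduleM modU) => //; apply: BA | apply: subringM].
- by move=> U V UV x [/UV].
- move=> U V [modU _] [modV VA] VU z Vz.
  have [w [Bw Aw w0 Bwz]] := frac _ (VA _ Vz).
  have [|Uwz _] := VU (w * z).
    by split=> //; apply: (submoduleM modV) => //; apply: BA.
  by rewrite -(mulKf w0 z); apply: (submoduleM modU).
Qed.

(** * Noetherian subrings generated by finitely many elements *)

(** The subring generated by [s] over the image of [R] is presented as the image
    of an iterated polynomial ring: the basis theorem applies to its source, and
    integrality over it is integrality along the evaluation morphism. *)
Lemma noetherian_model (R : comNzRingType) (K : comNzRingType)
    (f0 : {rmorphism R -> K}) (T : set K) (s : seq K) :
  max_condition (@is_ideal R) -> subring T -> range f0 `<=` T ->
  [set` s] `<=` T ->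
  exists (P : comNzRingType) (g : {rmorphism R -> P}) (f : {rmorphism P -> K}),
    [/\ max_condition (@is_ideal P), forall r, f (g r) = f0 r,
        [set` s] `<=` range f & range f `<=` T].
Proof.
move=> maxR ringT f0T; elim: s => [|t s IHs] sT.
  by exists R, idfun, f0; split.
have [|P [g [f [maxP fg sf fT]]]] := IHs.
  by move=> y sy; apply: sT; rewrite /= inE (_ : y \in s) ?orbT.
have Tt : T t by apply: sT; rewrite /= mem_head.
have cft : commr_rmorph f t by move=> x; apply: mulrC.
exists {poly P}, (polyC \o g), (horner_morph cft); split.
- exact: hilbert_basis.
- by move=> r /=; rewrite horner_morphC fg.
- move=> y /=; rewrite inE => /orP[/eqP->|/sf[x _ <-]].
    by exists 'X; rewrite ?horner_morphX.
  by exists x%:P; rewrite ?horner_morphC.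
- move=> _ [h _ <-]; elim/poly_ind: h => [|h c IHh].
    by rewrite rmorph0; apply: subring0.
  rewrite rmorphD rmorphM /= horner_morphX horner_morphC.
  apply: subringD => //; last by apply: fT; exists c.
  exact: subringM.
Qed.

(** * Dominating a finitely generated proper ideal *)

Definition coefs_in (K : comNzRingType) (V : set K) (f : {poly K}) : Prop :=
  forall i, V f`_i.

Definition adjoin (K : comNzRingType) (V : set K) (x : K) : set K :=
  [set f.[x] | f in coefs_in V].

Lemma coefs_inM (K : comNzRingType) (T I : set K) f g :
  subring T -> submodule T I -> coefs_in T f -> coefs_in I g ->
  coefs_in I (f * g).
Proof.
move=> ringT modI Tf Ig i; rewrite coefM.
by apply: (submodule_sum modI) => j; apply: (submoduleM modI).
Qed.

Lemma sub_adjoin (K : comNzRingType) (V : set K) x :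
  V 0 -> V `<=` adjoin V x.
Proof.
move=> V0 v Vv; exists v%:P; rewrite ?hornerC // => i.
by rewrite coefC; case: eqP.
Qed.

Lemma adjoinS (K : comNzRingType) (V W : set K) x :
  V `<=` W -> adjoin V x `<=` adjoin W x.
Proof. by move=> VW _ [f Vf <-]; exists f => // i; apply: VW. Qed.

Lemma adjoin_submodule (K : comNzRingType) (T I : set K) x :
  subring T -> submodule T I -> submodule (adjoin T x) (adjoin I x).
Proof.
move=> ringT modI; split.
- exists 0; rewrite ?horner0 // => i.
  by rewrite coef0; apply: (submodule0 modI).
- move=> _ _ [f If <-] [g Ig <-]; exists (f + g); rewrite ?hornerD // => i.
  by rewrite coefD; apply: (submoduleD modI).
- move=> _ _ [f If <-] [g Ig <-]; exists (f * g); rewrite ?hornerM //.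
  exact: coefs_inM ringT modI _ _.
Qed.

Lemma adjoin_subring (K : comNzRingType) (T : set K) x :
  subring T -> subring (adjoin T x).
Proof.
move=> ringT; have modT := subring_submodule ringT; split.
- by apply: sub_adjoin; [apply: subring0 | apply: subring1].
- move=> _ _ [f If <-] [g Ig <-]; exists (f - g); last first.
    by rewrite hornerD hornerN.
  by move=> i; rewrite coefB; apply: subringB.
- by have [] := adjoin_submodule x ringT modT.
Qed.

Lemma adjoin_gen (K : comNzRingType) (T : set K) x :
  subring T -> adjoin T x x.
Proof.
move=> ringT; exists 'X; rewrite ?hornerX // => i.
by rewrite coefX; case: eqP => _; [apply: subring1 | apply: subring0].
Qed.

(** The elimination step in Chevalley's extension theorem: the relation
    [g.[x^-1] = 1] rewrites the top term of the relation [f.[x] = 1] in lower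
    degree. *)
Lemma relation_degree_drop (K : fieldType) (T I : set K) x (f g : {poly K}) :
  subring T -> ideal_in T I -> x != 0 ->
  coefs_in I f -> coefs_in I g -> f.[x] = 1 -> g.[x^-1] = 1 ->
  (size g <= size f)%N -> (1 < size f)%N ->
  exists h, [/\ coefs_in I h, h.[x] = 1 & (size h < size f)%N].
Proof.
move=> ringT [modI IT] x0 If Ig fx gx gf.
case sf: (size f) => [//|[//|m]] _.
(* Multiply the first relation by [1 - g`_0] and replace
   [(1 - g`_0) * x ^+ m.+1] in its top term by means of the second one. *)
pose h := \poly_(i < m.+1) (g`_0 *+ (i == 0%N) + (1 - g`_0) * f`_i
                            + f`_m.+1 * g`_(m.+1 - i)).
exists h; split; last by rewrite ltnS size_poly.
- move=> i; rewrite coef_poly; case: ifP => _; last exact: submodule0 modI.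
  apply: (submoduleD modI); last by apply: (submoduleM modI) => //; apply: IT.
  apply: (submoduleD modI).
    by rewrite mulrb; case: ifP => _ //; apply: (submodule0 modI).
  apply: (submoduleM modI) => //.
  by apply: subringB => //; [apply: subring1 | apply: IT].
have fE : \sum_(i < m.+1) f`_i * x ^+ i = 1 - f`_m.+1 * x ^+ m.+1.
  by move: fx; rewrite horner_coef sf big_ord_recr /= => <-; rewrite addrK.
have gE : \sum_(i < m.+1) g`_(m.+1 - i) * x ^+ i = (1 - g`_0) * x ^+ m.+1.
  have -> : 1 - g`_0 = \sum_(i < m.+1) g`_i.+1 * x^-1 ^+ i.+1.
    move: gx; rewrite (@horner_coef_wide _ m.+2) -?sf //.
    by rewrite sf big_ord_recl /= mulr1 => <-; rewrite addrC addKr.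
  rewrite (reindex_inj rev_ord_inj) mulr_suml; apply: eq_bigr => i _ /=.
  rewrite subSS subSn ?leq_subr // subKn -1?ltnS // -mulrA exprVn.
  congr (_ * _).
  have -> : x ^+ m.+1 = x ^+ i.+1 * x ^+ (m - i).
    by rewrite -exprD addSn subnKC // -ltnS.
  by rewrite mulKf // expf_neq0.
rewrite horner_poly.
under eq_bigr do rewrite !mulrDl -!mulrA.
rewrite !big_split /= -!mulr_sumr fE gE big_ord_recl /= mulr1 big1 => [|i _].
  by ring.
by rewrite mulr0n mul0r.
Qed.

(** Chevalley's lemma. If the ideal became the unit ideal in both extensions,
    one could alternately lower the degrees of the two relations expressing
    this, until one of them puts [1] into [I]. *)
Lemma adjoin_proper (K : fieldType) (T I : set K) x :
  subring T -> ideal_in T I -> ~ I 1 -> x != 0 ->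
  ~ adjoin I x 1 \/ ~ adjoin I x^-1 1.
Proof.
move=> ringT idI I1 x0; apply: contrapT => /not_orP[].
move=> /contrapT[f If fx] /contrapT[g Ig gx].
have [n] := ubnP (size f + size g)%N.
elim: n => // n IHn in x x0 f g If Ig fx gx *; rewrite ltnS => fgn.
wlog gf : x x0 f g If Ig fx gx fgn / (size g <= size f)%N.
  move=> wl; have [|/ltnW] := leqP (size g) (size f); first exact: wl gx fgn.
  by apply: (wl x^-1); rewrite ?invr_eq0 ?invrK // addnC.
have [sf|sf] := leqP (size f) 1.
  by apply: I1; move: fx; rewrite (size1_polyC sf) hornerC => <-.
have [h [Ih hx hf]] := relation_degree_drop ringT idI x0 If Ig fx gx gf sf.
by apply: (IHn x x0 h g) => //; rewrite (leq_trans _ fgn) // ltn_add2r.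
Qed.

(** Blowing up: after a finitely generated extension inside the field, a
    finitely generated proper ideal becomes principal, generated by one of the
    given elements, and stays proper. In each step Chevalley's lemma decides
    which of two elements is to divide the other. *)
Lemma dominating_generator (K : fieldType) (T I : set K) (s : seq K) :
  subring T -> ideal_in T I -> ~ I 1 -> s != [::] ->
  (forall b, b \in s -> I b /\ b != 0) ->
  exists T' : set K, [/\ subring T', T `<=` T' &
    exists2 a, a \in s & (forall b, b \in s -> T' (b / a)) /\ ~ T' a^-1].
Proof.
move=> ringT idI I1 s0 sI.
(* The induction carries along a proper ideal containing the given one: it keeps
   [a] from becoming invertible. *)
suff [T' [I' [ringT' [TT' II' [modI' _] I'1] [a sa dvda]]]] :
  exists T' I' : set K, [/\ subring T',
    [/\ T `<=` T', I `<=` I', ideal_in T' I' & ~ I' 1] &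
    exists2 a, a \in s & forall b, b \in s -> T' (b / a)].
  exists T'; split=> //; exists a => //; split=> // Ta.
  have [Ia a0] := sI a sa.
  apply: I'1; rewrite -(mulVf a0).
  by apply: (submoduleM modI') => //; apply: II'.
case: s s0 sI => // a s _; elim: s a => [|b s IHs] a sI.
  exists T, I; split; [exact: ringT | by split |].
  exists a; first exact: mem_head.
  move=> b; rewrite inE => /eqP->; have [_ a0] := sI a (mem_head _ _).
  by rewrite divff //; apply: subring1.
have [|T1 [I1' [ringT1 [TT1 II1 idI1 I11] [c sc dvdc]]]] := IHs b.
  by move=> d sd; apply: sI; rewrite inE sd orbT.
have [_ a0] := sI a (mem_head _ _).
have [_ c0] : I c /\ c != 0 by apply: sI; rewrite inE sc orbT.
have ac0 : a / c != 0 by rewrite mulf_neq0 ?invr_neq0.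
have step x : ~ adjoin I1' x 1 ->
    [/\ subring (adjoin T1 x), T1 `<=` adjoin T1 x &
      [/\ T `<=` adjoin T1 x, I `<=` adjoin I1' x,
          ideal_in (adjoin T1 x) (adjoin I1' x) & ~ adjoin I1' x 1]].
  have [mod1 sub1] := idI1; have T1x : T1 `<=` adjoin T1 x.
    by apply: sub_adjoin; apply: subring0.
  move=> I1x; split=> //; first exact: adjoin_subring.
  split=> //; first exact: subset_trans T1x.
    by apply: (subset_trans II1); apply: sub_adjoin; apply: (submodule0 mod1).
  by split; [apply: adjoin_submodule | apply: adjoinS].
have [/step|/step] := adjoin_proper ringT1 idI1 I11 ac0.
- move=> [ringx T1x prop]; exists (adjoin T1 (a / c)), (adjoin I1' (a / c)).
  split=> //; exists c; first by rewrite inE sc orbT.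
  move=> d; rewrite inE => /orP[/eqP->|/dvdc]; first exact: adjoin_gen.
  exact: T1x.
- rewrite invf_div.
  move=> [ringx T1x prop]; exists (adjoin T1 (c / a)), (adjoin I1' (c / a)).
  split=> //; exists a; first exact: mem_head.
  move=> d; rewrite inE => /orP[/eqP->|/dvdc Td].
    by rewrite divff //; apply: subring1.
  rewrite (_ : d / a = d / c * (c / a)); last by rewrite mulrA divfK.
  by apply: subringM => //; [apply: T1x | apply: adjoin_gen].
Qed.

(** * Almost integral inverses over a Noetherian domain *)

(** A Noetherian ring all of whose non-units are nilpotent modulo [a] is of
    finite length modulo [a], so that descending chains of ideals are
    stationary modulo [a]. *)
Lemma descending_chain_mod (K : fieldType) (A : set K) a (D : nat -> set K) :
  subring A -> max_condition (ideal_in A) -> A a -> a != 0 ->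
  (forall x, A x -> A x^-1 /\ x != 0 \/ exists n, A (x ^+ n / a)) ->
  (forall n, ideal_in A (D n)) -> (forall m n, (m <= n)%N -> D n `<=` D m) ->
  exists n, forall d, D n d ->
    exists2 d', D n.+1 d' & exists2 y, A y & d - d' = a * y.
Proof.
move=> ringA maxA Aa a0 unit_or_nil idD D_desc.
pose stable (U : set K) := exists n0, forall n, (n0 <= n)%N ->
  forall d, D n d -> exists2 d', D n.+1 d' & U (d - d').
pose aA := [set a * y | y in A].
suff [n0 n0P] : stable aA.
  exists n0 => d /(n0P _ (leqnn _))[d' Dd' [y Ay yE]]; exists d' => //.
  by exists y.
have id_aA : ideal_in A aA.
  split; last by move=> _ [y Ay <-]; apply: subringM.
  split; first by exists 0; rewrite ?mulr0 //; apply: subring0.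
  - move=> _ _ [y Ay <-] [z Az <-]; exists (y + z); first exact: subringD.
    by rewrite mulrDr.
  - move=> t _ At [y Ay <-]; exists (t * y); first exact: subringM.
    by rewrite mulrCA.
(* Take M maximal among the ideals containing aA modulo which the chain is
   not stationary; an element x of the socle of A / M then leads to a
   contradiction, since the chain is stationary modulo M + xA. *)
apply: contrapT => aA_unstable.
have [||M [[modM MA] aAM Munst] Mmax] :=
  maxA [set U | [/\ ideal_in A U, aA `<=` U & ~ stable U]].
- by exists aA; split.
- by move=> U [].
have M1 : ~ M 1.
  move=> M1; apply: Munst; exists 0%N => n _ d Dd.
  exists 0; first exact: (submodule0 (idD _).1).
  rewrite subr0 -(mulr1 d); apply: (submoduleM modM) => //.
  exact: (idD n).2.
pose colon x := [set r | A r /\ M (r * x)].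
have [||_ [x [Ax Mx] <-] xmax] :=
  maxA [set colon x | x in [set x | A x /\ ~ M x]].
- by exists (colon 1); exists 1 => //; split=> //; apply: subring1.
- move=> _ [x [Ax Mx] <-]; split; last by move=> r [].
  split.
  + by split; [apply: subring0 | rewrite mul0r; apply: (submodule0 modM)].
  + move=> y z [Ay My] [Az Mz]; split; first exact: subringD.
    by rewrite mulrDl; apply: (submoduleD modM).
  + move=> t z At [Az Mz]; split; first exact: subringM.
    by rewrite -mulrA; apply: (submoduleM modM).
have nonunit y : A y -> (exists n, A (y ^+ n / a)) -> M (y * x).
  move=> Ay [n Ayn]; apply: contrapT => Myx.
  have Mpow k : ~ M (y ^+ k * x).
    elim: k => [|k IHk]; first by rewrite mul1r.
    rewrite exprSr -mulrA => Mk.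
    have [|||] // := xmax (colon (y * x)) _ _ (y ^+ k).
    - by exists (y * x) => //; split=> //; apply: subringM.
    - move=> r [Ar Mrx]; split=> //; rewrite mulrCA.
      by apply: (submoduleM modM).
    - by split=> //; apply: subringX.
  apply: (Mpow n); rewrite mulrC; apply: (submoduleM modM) => //.
  by apply: aAM; exists (y ^+ n / a) => //; rewrite mulrC divfK.
have [n0 n0P] : stable (extend A M x).
  have MMx : M `<=` extend A M x by apply: sub_extend.
  apply: contrapT => Mx_unst; apply: Mx; apply: (Mmax (extend A M x)) => //.
    split=> //; last exact: subset_trans MMx.
    split; first exact: extend_submodule.
    by apply: extend_sub => //; apply: subring_submodule.
  exact: extend_gen.
have [xD|/existsNP[n1 xD]] := pselect (forall n, exists2 e, D n e & M (x - e)).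
- apply: Munst; exists n0 => n n0n d Dd.
  have [d' Dd' [m Mm [r Ar dE]]] := n0P _ n0n _ Dd.
  have [e De Me] := xD n.+1.
  exists (d' + r * e).
    by apply: (submoduleD (idD _).1) => //; apply: (submoduleM (idD _).1).
  rewrite opprD addrA dE -addrA -mulrBr.
  by apply: (submoduleD modM) => //; apply: (submoduleM modM).
- apply: Munst; exists (maxn n0 n1) => n.
  rewrite geq_max => /andP[n0n n1n] d Dd.
  have [d' Dd' [m Mm [r Ar dE]]] := n0P _ n0n _ Dd.
  exists d' => //; rewrite dE; apply: (submoduleD modM) => //.
  have [[Ar1 r0]|] := unit_or_nil r Ar; last exact: nonunit.
  case: xD; exists (r^-1 * (d - d')).
    apply: (D_desc _ _ n1n); apply: (submoduleM (idD _).1) => //.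
    apply: (submoduleB ringA (idD _).1) => //.
    exact: (D_desc _ _ (leqnSn _)).
  rewrite dE mulrDr mulKf // opprD addrCA subrr addr0.
  by apply: (submoduleN ringA modM); apply: (submoduleM modM).
Qed.

(** Krull's principal ideal theorem in the form needed here: in a local
    Noetherian domain whose maximal ideal is minimal over [a], every nonzero
    [c] divides a power of [a]. As in Krull's proof, a descending chain of
    saturated ideals stabilizes modulo [a], hence stabilizes by the argument of
    Nakayama's lemma; here these ideals are the traces of the powers of [c] in
    the ring with [a] inverted. *)
Lemma dvd_power_of_minimal (K : fieldType) (A : set K) a c :
  subring A -> max_condition (ideal_in A) -> A a -> ~ A a^-1 ->
  (forall x, A x -> A x^-1 /\ x != 0 \/ exists n, A (x ^+ n / a)) ->
  A c -> c != 0 -> exists k, A (a ^+ k / c).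
Proof.
move=> ringA maxA Aa Aa1 unit_or_nil Ac c0.
have a0 : a != 0.
  by apply: contra_notN Aa1 => /eqP->; rewrite invr0; apply: subring0.
pose D n := saturation A a (c ^+ n).
have idD n : ideal_in A (D n) by apply: saturation_ideal.
have D_desc m n : (m <= n)%N -> D n `<=` D m.
  move=> mn x [Ax [k Akx]]; split=> //; exists k.
  rewrite (_ : _ / _ = a ^+ k * x / c ^+ n * c ^+ (n - m)); last first.
    have -> : c ^+ n = c ^+ m * c ^+ (n - m) by rewrite -exprD subnKC.
    by field; rewrite !expf_neq0.
  by apply: subringM => //; apply: subringX.
have [n stab] := descending_chain_mod ringA maxA Aa a0 unit_or_nil idD D_desc.
suff DS : D n `<=` D n.+1.
  have [|_ [k Ak]] := DS (c ^+ n).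
    split; first exact: subringX.
    by exists 0%N; rewrite mul1r divff ?expf_neq0 //; apply: subring1.
  exists k; rewrite (_ : _ / _ = a ^+ k * c ^+ n / c ^+ n.+1) // exprSr.
  by field; rewrite c0 expf_neq0.
have [modD _] := idD n; have [modD' _] := idD n.+1.
have nakayama d : D n d ->
    exists2 d', D n.+1 d' & exists2 y, D n y & d = d' + a * y.
  move=> Dd; have [d' Dd' [y Ay dE]] := stab _ Dd; exists d' => //.
  exists y; last by rewrite -dE addrC subrK.
  have [_ [k Ak]] : D n (a * y).
    rewrite -dE; apply: (submoduleB ringA modD) => //.
    exact: (D_desc _ _ (leqnSn _)).
  by split=> //; exists k.+1; rewrite exprSr -(mulrA _ a).
(* Were D n.+1 smaller, a maximal proper submodule U of D n above it would
   contain a * D n, hence D n. *)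
apply: contrapT => DS.
have [||U [[modU UA] DU UD DnU] Umax] :=
  maxA [set U | [/\ ideal_in A U, D n.+1 `<=` U, U `<=` D n & ~ D n `<=` U]].
- by exists (D n.+1); split=> //; apply: D_desc.
- by move=> V [].
have [y Dy Uy] : exists2 y, D n y & ~ U y.
  apply: contrapT => H; apply: DnU => y Dy; apply: contrapT => Uy.
  by apply: H; exists y.
have extend_max z : D n z -> ~ U z -> D n `<=` extend A U z.
  move=> Dz Uz; apply: contrapT => Dspan; apply: Uz.
  have UUz : U `<=` extend A U z by apply: sub_extend.
  have UzD : extend A U z `<=` D n by apply: extend_sub.
  apply: (Umax (extend A U z)) => //; last exact: extend_gen.
  split=> //; last exact: subset_trans UUz.
  split; first exact: extend_submodule.
  by apply: (subset_trans UzD); apply: (idD n).2.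
have Uay : U (a * y).
  apply: contrapT => Uay.
  have [|u Uu [r Ar yE]] := extend_max (a * y) _ Uay y Dy.
    exact: (submoduleM modD).
  have As : A (1 - r * a).
    by apply: subringB => //; [apply: subring1 | apply: subringM].
  have sy : (1 - r * a) * y = u by rewrite mulrBl mul1r {1}yE -mulrA addrK.
  have [[As1 s0]|[k Ak]] := unit_or_nil _ As.
    by apply: Uy; rewrite -(mulKf s0 y) sy; apply: (submoduleM modU).
  apply: Aa1.
  (* A power of [1 - ra] is again of the form [1 - ta]. *)
  have [t At tE] : exists2 t, A t & (1 - r * a) ^+ k = 1 - t * a.
    elim: (k) => [|l [t At tE]].
      by exists 0; [apply: subring0 | rewrite mul0r subr0].
    exists (t + r - r * t * a); last by rewrite exprS tE; ring.
    apply: subringB => //; first exact: subringD.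
    by apply: subringM => //; apply: subringM.
  move: Ak; rewrite tE mulrBl mul1r mulfK // => Ak.
  by rewrite -(subrK t a^-1); apply: subringD.
apply: DnU => d Dd; have [d' Dd' [z Dz ->]] := nakayama d Dd.
apply: (submoduleD modU); first exact: DU.
have [u Uu [r Ar ->]] := extend_max y Dy Uy z Dz.
rewrite mulrDr mulrCA; apply: (submoduleD modU); exact: (submoduleM modU).
Qed.

(** An integral equation of [u], multiplied by [r ^+ n * a ^+ n.-1] where [n] is
    its degree, expresses [a^-1] in terms of [a], [r] and the coefficients. *)
Lemma inv_mem_of_integral (P : comNzRingType) (K : fieldType)
    (f : {rmorphism P -> K}) (A : set K) a u r :
  subring A -> range f `<=` A -> A a -> A r -> a^-1 = u * r ->
  integralOver f u -> A a^-1.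
Proof.
move=> ringA fA Aa Ar aE [h monh /rootP hu].
have [->|a0] := eqVneq a 0; first by rewrite invr0; apply: subring0.
case sh: (size h) => [|[|m]].
- by move: (monic_neq0 monh); rewrite -size_poly_eq0 sh.
- have /size1_polyC hE : (size h <= 1)%N by rewrite sh.
  move: monh hu; rewrite monicE lead_coefE sh /= => /eqP h0.
  by rewrite hE h0 rmorph1 hornerC => /eqP; rewrite oner_eq0.
have lc : (map_poly f h)`_m.+1 = 1.
  move: monh; rewrite coef_map monicE lead_coefE sh /= => /eqP->.
  by rewrite rmorph1.
move: hu; rewrite (@horner_coef_wide _ m.+2); last first.
  by rewrite -sh size_poly.
rewrite big_ord_recr /= lc mul1r => /eqP; rewrite addrC addr_eq0 => /eqP sumE.
have -> : a^-1 =
    - \sum_(i < m.+1) f h`_i * r ^+ (m.+1 - i) * a ^+ (m - i).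
  transitivity ((u * r) ^+ m.+1 * a ^+ m).
    by rewrite -aE exprSr exprVn mulrAC mulVf ?mul1r // expf_neq0.
  rewrite exprMn sumE !mulNr !mulr_suml; congr (- _).
  apply: eq_bigr => i _; rewrite coef_map /=.
  have im : (i <= m)%N by rewrite -ltnS.
  have -> : r ^+ m.+1 = r ^+ i * r ^+ (m.+1 - i).
    by rewrite -exprD subnKC // ltnW.
  have -> : a ^+ m = a ^+ i * a ^+ (m - i) by rewrite -exprD subnKC.
  have uE : u ^+ i * r ^+ i * a ^+ i = 1.
    by rewrite -!exprMn -aE mulVf // expr1n.
  transitivity (f h`_i * r ^+ (m.+1 - i) * a ^+ (m - i)
                * (u ^+ i * r ^+ i * a ^+ i)).
    by ring.
  by rewrite uE mulr1.
apply: subringN => //; apply: (submodule_sum (subring_submodule ringA)) => i.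
apply: subringM => //; last exact: subringX.
by apply: subringM => //; [apply: fA; exists h`_i | apply: subringX].
Qed.

(** Localize at a minimal prime of [a]: there [c] divides some power of [a], and
    the integrality of the quotient of [c] by a higher power makes [a]
    invertible, which is absurd. *)
Lemma inv_mem_of_almost_integral (P : comNzRingType) (K : fieldType)
    (f : {rmorphism P -> K}) a c :
  max_condition (@is_ideal P) -> range f a -> range f c -> c != 0 ->
  (forall k, exists2 q, (k <= q)%N & integralOver f (c / a ^+ q)) ->
  range f a^-1.
Proof.
move=> maxP; set B := range f => Ba Bc c0 integral_quotients.
have ringB : subring B := image_subring f.
have maxB : max_condition (ideal_in B) := max_condition_image maxP.
apply: contrapT => Ba1.
have a0 : a != 0.
  by apply: contra_notN Ba1 => /eqP->; rewrite invr0; apply: subring0.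
(* W below is the complement of a minimal prime of a. Let g have no power in aB;
   the x such that xg is nilpotent modulo a form the colon ideal of the radical
   of aB by g, and this is a minimal prime as soon as the saturation of aB with
   respect to g is maximal. *)
pose free g := B g /\ forall k, ~ B (g ^+ k / a).
have [||_ [g [Bg free_g] <-] gmax] :=
  maxB [set saturation B g a | g in free].
- exists (saturation B 1 a); exists 1 => //; split; first exact: subring1.
  by move=> k; rewrite expr1n mul1r.
- by move=> _ [g [Bg _] <-]; apply: saturation_ideal.
pose W := [set w | B w /\ forall k, ~ B ((w * g) ^+ k / a)].
have W1 : W 1 by split=> [|k]; [apply: subring1 | rewrite mul1r; apply: free_g].
have WM x y : W x -> W y -> W (x * y).
  move=> [Bx Wx] [By Wy]; split=> [|k Bk]; first exact: subringM.
  have [|||_ [l Bl]] := gmax (saturation B (x * g) a) _ _ (y ^+ k).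
  - by exists (x * g) => //; split=> //; apply: subringM.
  - move=> z [Bz [l Bl]]; split=> //; exists l.
    rewrite exprMn -!mulrA; apply: subringM => //; first exact: subringX.
    by rewrite mulrA.
  - split; first exact: subringX.
    by exists k; rewrite -exprMn mulrAC.
  apply: (Wy (k + l)%N).
  rewrite (_ : _ / a = y ^+ l * g ^+ k * (g ^+ l * y ^+ k / a)); last first.
    by rewrite exprMn !exprD; ring.
  by apply: subringM => //; apply: subringM => //; apply: subringX.
have Wg : W g by split=> // k; rewrite -expr2 -exprM; apply: free_g.
have WX w k : W w -> W (w ^+ k).
  by move=> Ww; elim: k => [|k IHk]; rewrite ?exprS //; apply: WM.
have W0 w : W w -> w != 0.
  case=> _ Ww; apply/eqP => w0; apply: (Ww 1%N).
  by rewrite w0 mul0r expr1 mul0r; apply: subring0.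
pose A := [set z | exists2 w, W w & B (w * z)].
have BA : B `<=` A by move=> z Bz; exists 1; rewrite ?mul1r.
have ringA : subring A.
  split; first by apply: BA; apply: subring1.
  - move=> x y [v Wv Bvx] [w Ww Bwy]; exists (v * w); first exact: WM.
    have -> : v * w * (x - y) = w * (v * x) - v * (w * y) by ring.
    by apply: subringB => //; apply: subringM => //; [case: Ww | case: Wv].
  - move=> x y [v Wv Bvx] [w Ww Bwy]; exists (v * w); first exact: WM.
    by rewrite mulrACA; apply: subringM.
have maxA : max_condition (ideal_in A).
  apply: (max_condition_localization ringB BA) maxB => z [w Ww Bwz].
  exists w; split=> //; [by case: Ww | | exact: W0].
  by exists w; rewrite ?divff ?W0 //; apply: subring1.
have Aa1 : ~ A a^-1.
  move=> [w [Bw Ww] Bwa]; apply: (Ww 1%N); rewrite expr1 mulrAC.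
  exact: subringM.
have unit_or_nil x : A x -> A x^-1 /\ x != 0 \/ exists n, A (x ^+ n / a).
  move=> [w Ww Bwx]; have [Wwx|Wwx] := pselect (W (w * x)).
    have := W0 _ Wwx; rewrite mulf_eq0 negb_or => /andP[w0 x0].
    by left; split=> //; exists (w * x); rewrite ?mulfK //; case: Ww.
  right; have [k Bk] : exists k, B ((w * x * g) ^+ k / a).
    by apply: contrapT => /forallNP H; apply: Wwx.
  exists k; exists ((w * g) ^+ k); first by apply: WX; apply: WM.
  by rewrite mulrA -exprMn mulrAC.
have [k Ak] :=
  dvd_power_of_minimal ringA maxA (BA _ Ba) Aa1 unit_or_nil (BA _ Bc) c0.
have [q kq] := integral_quotients k.+1.
apply: contra_not Aa1; apply: (inv_mem_of_integral ringA BA (BA _ Ba)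
  (r := a ^+ k / c * a ^+ (q - k.+1))).
- by apply: subringM => //; apply: subringX => //; apply: BA.
- have -> : a ^+ q = a * a ^+ k * a ^+ (q - k.+1).
    by rewrite -exprS -exprD subnKC.
  by field; rewrite ?expf_neq0 ?a0 ?c0.
Qed.

(** * Coherence and colon ideals *)

Lemma ideal_gen_ideal (A : comNzRingType) (X : set A) : is_ideal (ideal_gen X).
Proof.
split=> [J [[J0 _ _] _]|x y Ix Iy J JX|a x Ix J JX]; first exact: J0.
- by have [[_ JD _] _] := JX; apply: JD; [apply: Ix | apply: Iy].
- by have [[_ _ JM] _] := JX; apply: JM; apply: Ix.
Qed.

Lemma ideal_sum (A : comNzRingType) (I : set A) n (t s : 'I_n -> A) :
  is_ideal I -> (forall i, I (s i)) -> I (\sum_i t i * s i).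
Proof. by case=> I0 ID IM Is; elim/big_ind: _ => // i _; apply: IM. Qed.

Lemma ideal_gen_seqP (A : comNzRingType) (s : seq A) x :
  ideal_gen [set` s] x -> exists t : 'I_(size s) -> A, x = \sum_i t i * s`_i.
Proof.
move: x; apply: (smallest_sub (X := [set x | exists t, x = _])).
  split=> [|_ _ [t ->] [u ->]|a _ [t ->]].
  - by exists (fun=> 0); rewrite big1 // => i _; rewrite mul0r.
  - exists (fun i => t i + u i); rewrite -big_split.
    by apply: eq_bigr => i _; rewrite mulrDl.
  - exists (fun i => a * t i); rewrite mulr_sumr.
    by apply: eq_bigr => i _; rewrite mulrA.
move=> y /= sy; have iy : (index y s < size s)%N by rewrite index_mem.
exists (fun i => (i == Ordinal iy)%:R).
rewrite (bigD1 (Ordinal iy)) //= eqxx mul1r nth_index // big1 ?addr0 //.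
by move=> i /negPf->; rewrite mul0r.
Qed.

Lemma ideal_gen_consP (A : comNzRingType) x (s : seq A) z :
  ideal_gen [set` x :: s] z -> exists r, ideal_gen [set` s] (z - r * x).
Proof.
have [I0 ID IM] := ideal_gen_ideal [set` s].
move: z; apply: (smallest_sub (X := [set z | exists r, _ (z - r * x)])).
  split=> [|y z [r Ir] [t It]|a y [r Ir]].
  - by exists 0; rewrite mul0r subr0.
  - by exists (r + t); rewrite mulrDl opprD addrACA; apply: ID.
  - by exists (a * r); rewrite -mulrA -mulrBr; apply: IM.
move=> y /=; rewrite inE => /orP[/eqP->|sy].
  by exists 1; rewrite mul1r subrr.
by exists 0; rewrite mul0r subr0; apply: sub_gen_smallest.
Qed.

(** The annihilator of [x] modulo [I] is the kernel of the multiplication by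
    [x] from [A] onto [(I + xA) / I]. As a presentation of [I + xA] provides one
    of this quotient, Schanuel's comparison argument makes the kernel finitely
    generated: the linear form [phi] below lifts the presentation to [A]. *)
Lemma coherent_colon (A : comNzRingType) (I : set A) x :
  coherent A -> fg_ideal I -> fg_ideal [set y | I (y * x)].
Proof.
move=> cohA [s ->].
have idI := ideal_gen_ideal [set` s]; have [I0 ID IM] := idI.
set I_ := ideal_gen [set` s] in idI I0 ID IM *.
have [|m [n [h [g [g_range h_range]]]]] := cohA (ideal_gen [set` x :: s]).
  by exists (x :: s).
have lift z : z \in x :: s -> exists v, g v = z.
  move=> xsz; suff [v _ vz] : range g z by exists v.
  by rewrite g_range; apply: sub_gen_smallest.
have [ex gex] := lift x (mem_head _ _).
have /choice[w gw] (i : 'I_(size s)) : exists v, g v = s`_i.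
  by apply: lift; rewrite inE mem_nth ?orbT.
have /choice[r gr] (i : 'I_n) : exists r, I_ (g 'e_i - r * x).
  by apply: ideal_gen_consP; rewrite -g_range; exists 'e_i.
pose phi (v : 'rV[A]_n) := (v *m \col_i r i) 0 0.
have phi_g v : I_ (g v - phi v * x).
  suff -> : g v - phi v * x = \sum_i v 0 i * (g 'e_i - r i * x).
    exact: ideal_sum.
  rewrite {1}(row_sum_delta v) linear_sum /phi mxE mulr_suml -sumrB.
  apply: eq_bigr => i _; rewrite linearZ mxE -mulrA /=.
  by rewrite -[_ *: _]/(v 0 i * g 'e_i) -mulrBr.
have phi_ker v : I_ (g v) -> I_ (phi v * x).
  move=> Iv; rewrite -[_ * x]opprK -mulN1r; apply: (IM).
  by rewrite -[- _](addKr (g v)) -mulN1r; apply: ID (phi_g v); apply: IM.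
have phiB v u : phi (v - u) = phi v - phi u by rewrite /phi mulmxBl !mxE.
have phi_comb k (t : 'I_k -> A) (u : 'I_k -> 'rV_n) :
    phi (\sum_i t i *: u i) = \sum_i t i * phi (u i).
  rewrite /phi mulmx_suml summxE; apply: eq_bigr => i _.
  by rewrite -scalemxAl mxE.
pose gens := (1 - phi ex) :: [seq phi (w j) | j <- enum 'I_(size s)]
                             ++ [seq phi (h 'e_l) | l <- enum 'I_m].
exists gens.
rewrite eqEsubset; split=> [y /= Iyx|]; last first.
  apply: smallest_sub => [|y /=].
    split=> [|y z|a y] /=; first by rewrite mul0r.
    - by rewrite mulrDl; apply: ID.
    - by rewrite -mulrA; apply: IM.
  rewrite /gens inE mem_cat => /or3P[/eqP->|/mapP[j _ ->]|/mapP[l _ ->]].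
  - by rewrite mulrBl mul1r -{1}gex; apply: phi_g.
  - by apply: phi_ker; rewrite gw; apply: sub_gen_smallest; apply: mem_nth.
  - apply: phi_ker; suff -> : g (h 'e_l) = 0 by [].
    by have : range h (h 'e_l) by [exists 'e_l]; rewrite h_range.
have [t tE] := ideal_gen_seqP Iyx.
have [u _ uE] : range h (y *: ex - \sum_j t j *: w j).
  suff gE : g (y *: ex - \sum_j t j *: w j) = y * x - \sum_j t j * s`_j.
    by rewrite h_range /= gE tE subrr.
  rewrite linearB linearZ linear_sum /= gex; congr (_ - _).
  by apply: eq_bigr => j _; rewrite linearZ /= gw.
have : y = y * (1 - phi ex) + \sum_j t j * phi (w j)
           + \sum_l u 0 l * phi (h 'e_l).
  rewrite -!phi_comb.
  have -> : \sum_l u 0 l *: h 'e_l = h u.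
    rewrite [in RHS](row_sum_delta u) linear_sum.
    by apply: eq_bigr => l _; rewrite linearZ.
  have phiZ : phi (y *: ex) = y * phi ex by rewrite /phi -scalemxAl mxE.
  by rewrite uE phiB phiZ; ring.
move=> ->; have idG := ideal_gen_ideal [set` gens].
have [_ GD GM] := idG; apply: (GD); first apply: (GD).
- by apply: GM; apply: sub_gen_smallest; apply: mem_head.
- apply: ideal_sum => // j; apply: sub_gen_smallest.
  rewrite /= /gens inE mem_cat; apply/or3P/Or32/mapP.
  by exists j; rewrite ?mem_enum.
- apply: ideal_sum => // l; apply: sub_gen_smallest.
  rewrite /= /gens inE mem_cat; apply/or3P/Or33/mapP.
  by exists l; rewrite ?mem_enum.
Qed.

(** * Tight closure in a perfect domain *)

Lemma perfect_bijective (p : nat) (A : comNzRingType) e :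
  perfect p A -> bijective (fun a : A => a ^+ (p ^ e)).
Proof.
move=> [_ Fbij]; elim: e => [|e IHe]; first by exists id => a; rewrite expr1.
by apply: (eq_bij (bij_comp Fbij IHe)) => a /=; rewrite -exprM expnSr.
Qed.

(** The [p^e]-th powers of the elements of [I] already form an ideal, since
    every scalar is itself a [p^e]-th power. *)
Lemma frobenius_power_perfect (p : nat) (A : comNzRingType) (I : set A) e x :
  perfect p A -> is_ideal I ->
  frobenius_power I (p ^ e) (x ^+ (p ^ e)) -> I x.
Proof.
move=> Aperf [I0 ID IM]; have [charA _] := Aperf.
have p_prime := pcharf_prime charA.
have [root rootK powK] := perfect_bijective e Aperf.
suff sub : frobenius_power I (p ^ e) `<=` [set y ^+ (p ^ e) | y in I].
  by move=> /sub[y Iy /(can_inj rootK)<-].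
apply: smallest_sub => //; split.
- by exists 0 => //; rewrite expr0n eqn0Ngt expn_gt0 prime_gt0.
- move=> _ _ [y Iy <-] [z Iz <-]; exists (y + z); first exact: ID.
  by apply: exprDn_pchar; rewrite pnatX (pnatE _ p_prime) charA.
- move=> a _ [y Iy <-]; exists (root a * y); first exact: IM.
  by rewrite exprMn powK.
Qed.

Lemma tight_closure_roots (p : nat) (S : idomainType) (I : set S) x :
  perfect p S -> is_ideal I -> tight_closure p I x ->
  exists2 c : S, c != 0 & exists e0, forall e, (e0 <= e)%N ->
    exists2 d, d ^+ (p ^ e) = c & I (d * x).
Proof.
move=> Sperf idI [c c0 [e0 cx]]; exists c => //; exists e0 => e /cx.
have [root _ powK] := perfect_bijective e Sperf.
move=> Icx; exists (root c) => //.
by apply: frobenius_power_perfect (e) _ Sperf idI _; rewrite exprMn powK.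
Qed.

Lemma sub_tight_closure (p : nat) (S : idomainType) (I : set S) :
  I `<=` tight_closure p I.
Proof.
move=> x Ix; exists 1; first exact: oner_neq0.
by exists 0%N => e _; rewrite mul1r; apply: sub_gen_smallest; exists x.
Qed.

(** * Ideals containing roots of a nonzero element *)

Lemma integralOver_factor (R P K : comNzRingType) (f0 : {rmorphism R -> K})
    (g : {rmorphism R -> P}) (f : {rmorphism P -> K}) u :
  (forall r, f (g r) = f0 r) -> integralOver f0 u -> integralOver f u.
Proof.
move=> fg [h monh hu]; exists (map_poly g h); first exact: monic_map.
rewrite -map_poly_comp; congr (root _ u): hu.
by apply: eq_map_poly => r /=; rewrite fg.
Qed.

Lemma integralX (R K : comNzRingType) (f : {rmorphism R -> K}) u n :
  integralOver f u -> integralOver f (u ^+ n).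
Proof.
move=> fu; elim: n => [|n IHn]; first exact: integral1.
by rewrite exprS; apply: integral_mul.
Qed.

(** Blowing up [J] turns the roots of [c] into multiples of a single generator
    [a], up to factors integral over a Noetherian ring [B]. Thus [c] is
    divisible by all powers of [a] in the integral closure of [B], which forces
    [a] to be invertible. *)
Lemma fg_ideal_roots_unit (p : nat) (p_gt1 : (1 < p)%N) (R S : idomainType)
    (K : fieldType) (iota : {rmorphism R -> S}) (F : {rmorphism S -> K})
    (J : set S) c e0 :
  injective F -> noetherian R -> integralRange iota -> fg_ideal J -> c != 0 ->
  (forall e, (e0 <= e)%N -> exists2 d, d ^+ (p ^ e) = c & J d) -> J 1.
Proof.
move=> F_inj noethR intS [s JE] c0 roots; apply: contrapT => J1.
have idJ : is_ideal J by rewrite JE; apply: ideal_gen_ideal.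
have F0 y : (F y == 0) = (y == 0) by apply: raddf_eq0.
(* Zero generators are discarded: they cannot serve as denominators. *)
pose s' := [seq F y | y <- s & y != 0].
have sJ y : y \in s -> J y by move=> sy; rewrite JE; apply: sub_gen_smallest.
have s'0 : s' != [::].
  apply/eqP => s'0; have Jnull : J `<=` [set 0].
    rewrite JE; apply: smallest_sub.
      by split=> [//|y z -> ->|a y ->]; rewrite ?addr0 ?mulr0.
    move=> y /= sy; apply/eqP; apply: contraT => y0.
    have : F y \in s' by apply: map_f; rewrite mem_filter y0.
    by rewrite s'0.
  have [d dc /Jnull d0] := roots e0 (leqnn _).
  by move: c0; rewrite -dc d0 expr0n expn_eq0 -leqn0 leqNgt (ltnW p_gt1) eqxx.
have idFJ : ideal_in (range F) (F @` J).
  have [J0 JD JM] := idJ; split; last by move=> _ [y _ <-]; exists y.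
  split; first by exists 0; rewrite ?rmorph0.
  - move=> _ _ [y Jy <-] [z Jz <-]; exists (y + z); first exact: JD.
    by rewrite rmorphD.
  - move=> _ _ [t _ <-] [y Jy <-]; exists (t * y); first exact: JM.
    by rewrite rmorphM.
have FJ1 : ~ (F @` J) 1.
  by move=> [y Jy y1]; apply: J1; rewrite -(F_inj y 1) ?rmorph1.
have [|T' [ringT' TT' [a s'a [dvda aT']]]] :=
    dominating_generator (image_subring F) idFJ FJ1 s'0.
  move=> b /mapP[y]; rewrite mem_filter => /andP[y0 sy] ->.
  by split; [exists y => //; apply: sJ | rewrite F0].
have [P [g [f [maxP fg gens fT']]]] :
  exists (P : comNzRingType) (g : {rmorphism R -> P})
      (f : {rmorphism P -> K}),
    [/\ max_condition (@is_ideal P), forall r, f (g r) = (F \o iota) r,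
        [set` [:: a, F c & [seq b / a | b <- s']]] `<=` range f &
        range f `<=` T'].
  apply: noetherian_model => //; first exact: noetherian_max_condition.
    by move=> _ [r _ <-]; apply: TT'; exists (iota r).
  move=> y /=; rewrite !inE => /or3P[/eqP->|/eqP->|/mapP[b /dvda Tb ->]] //.
    by move: s'a => /mapP[z _ ->]; apply: TT'; exists z.
  by apply: TT'; exists c.
apply: aT'; apply: fT'.
have int_quotient y : J y -> integralOver f (F y / a).
  move: y; rewrite JE; apply: smallest_sub.
    split=> [|y z fy fz|t y fy] /=.
    - by rewrite rmorph0 mul0r; apply: integral0.
    - by rewrite rmorphD mulrDl; apply: integral_add.
    - rewrite rmorphM -mulrA; apply: integral_mul => //.
      by apply: integralOver_factor fg _; apply: integral_rmorph.
  move=> y /= sy; have [->|y0] := eqVneq y 0.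
    by rewrite rmorph0 mul0r; apply: integral0.
  have [|b _ <-] := gens (F y / a); last exact: integral_id.
  rewrite /= !inE (map_f (fun b => b / a)) ?orbT //.
  by apply: map_f; rewrite mem_filter y0.
apply: (inv_mem_of_almost_integral (c := F c) maxP).
- by apply: gens; rewrite /= mem_head.
- by apply: gens; rewrite /= !inE eqxx orbT.
- by rewrite F0.
move=> k; have [|d dc Jd] := roots (maxn e0 k); first exact: leq_maxl.
exists (p ^ maxn e0 k)%N.
  by apply: leq_trans (ltnW (ltn_expl _ p_gt1)); apply: leq_maxr.
rewrite -dc rmorphXn -expr_div_n.
exact/integralX/int_quotient.
Qed.

Theorem proposition4p3 (p : nat) (p_prime : prime p)
    (R : idomainType) (R_char : p \in [pchar R]) (R_noeth : noetherian R)
    (S : idomainType) (S_perfect : perfect p S)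
    (iota : {rmorphism R -> S}) (iota_int : integral_extension iota)
    (I : set S) (I_fg : fg_ideal I) (I_ntc : ~ tightly_closed p I) :
  ~ coherent S.
Proof.
move=> S_coh; have [_ S_int] := iota_int.
have idI : is_ideal I by case: I_fg => s ->; apply: ideal_gen_ideal.
apply: I_ntc; rewrite /tightly_closed eqEsubset.
split=> [|x]; first exact: sub_tight_closure.
move=> /(tight_closure_roots S_perfect idI)[c c0 [e0 roots]].
have tofrac_inj : injective (@tofrac S).
  by move=> y z /eqP; rewrite tofrac_eq => /eqP.
rewrite -(mul1r x).
exact: (fg_ideal_roots_unit (prime_gt1 p_prime) tofrac_inj R_noeth S_int
  (coherent_colon x S_coh I_fg) c0 roots).
Qed.
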